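(* Given a finite presentation of a $\mathsf{fp}$-by-$\mathbb{Z}$ group $G$, the set of standard presentations for $G$ is recursively enumerable.
   Context: A group $G$ is $\mathsf{fp}$-by-$\mathbb{Z}$ if it has a finitely presented normal subgroup $H$ with $G/H\cong\mathbb{Z}$. A standard presentation for a $\mathsf{fp}$-by-$\mathbb{Z}$ group $G$ is a finite presentation of $G$ of the form $$\langle X,t \mid R,\ txt^{-1}=\alpha(x)\ (x\in X)\rangle,$$ where $R$ is a set of words in $X^{\pm1}$, each $\alpha(x)$ is a word in $X^{\pm1}$, and the assignment $x\mapsto\alpha(x)$ ($x\in X$) defines an automorphism $\alpha$ of the group $\langle X\mid R\rangle$. *)

(* Defs.v *)
From HB Require Import structures.
From mathcomp Require Import all_boot all_algebra.
From mathcomp Require Import boolp.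

Set Implicit Arguments.
Unset Strict Implicit.
Unset Printing Implicit Defensive.

Local Open Scope group_scope.
Local Open Scope quotient_scope.

(* The letter (i, false) is the i-th generator, (i, true) its formal inverse. *)
Definition word (n : nat) := seq ('I_n * bool).

Definition inv_letter n (a : 'I_n * bool) : 'I_n * bool := (a.1, ~~ a.2).

Definition inv_word n (w : word n) : word n := rev (map (@inv_letter n) w).

(* The generators are x_0, ..., x_(ngens - 1). *)
Record presentation := Presentation {
  ngens : nat;
  relators : seq (word ngens)
}.

(* The least congruence on words containing free cancellation (both a a^-1 and
   a^-1 a, since a ranges over letters of either sign) and r ~ 1 for each
   relator r; words modulo it form the group F(x_0, ...) / <<relators>>. *)
Inductive weq (P : presentation) : word (ngens P) -> word (ngens P) -> Prop :=
| weq_refl w : weq w w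
| weq_sym u v : weq u v -> weq v u
| weq_trans u v w : weq u v -> weq v w -> weq u w
| weq_cat u u' v v' : weq u u' -> weq v v' -> weq (u ++ v) (u' ++ v')
| weq_cancel a : weq [:: a; inv_letter a] [::]
| weq_relator r : r \in relators P -> weq r [::].

Arguments weq P u v : clear implicits.

Lemma inv_letterK n : involutive (@inv_letter n).
Proof. by case=> i b; rewrite /inv_letter /= negbK. Qed.

Lemma inv_wordK n : involutive (@inv_word n).
Proof.
by move=> w; rewrite /inv_word map_rev revK mapK //; apply: inv_letterK.
Qed.

Section PresentedGroup.
Variable P : presentation.

Definition weqb : rel (word (ngens P)) := fun u v => `[< weq P u v >].

Lemma weqb_refl : reflexive weqb.
Proof. by move=> w; apply/asboolP; apply: weq_refl. Qed.

Lemma weqb_sym : symmetric weqb.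
Proof. by move=> u v; apply/asboolP/asboolP; apply: weq_sym. Qed.

Lemma weqb_trans : transitive weqb.
Proof.
move=> v u w /asboolP uv /asboolP vw; apply/asboolP.
exact: weq_trans uv vw.
Qed.

Canonical weq_equiv := EquivRel weqb weqb_refl weqb_sym weqb_trans.

Definition presented_group := {eq_quot weq_equiv}.
HB.instance Definition _ := EqQuotient.on presented_group.
HB.instance Definition _ := Choice.on presented_group.

Definition word_class (w : word (ngens P)) : presented_group :=
  \pi_presented_group w.

Lemma word_classP u v : word_class u = word_class v <-> weq P u v.
Proof.
split=> [/eqmodP/asboolP // | uv].
by apply/eqmodP/asboolP.
Qed.

Lemma weq_repr w : weq P (repr (word_class w)) w.
Proof. by apply/word_classP; rewrite /word_class reprK. Qed.

Lemma weq_mulV w : weq P (w ++ inv_word w) [::].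
Proof.
elim: w => [|a w IHw]; first exact: weq_refl.
have -> : inv_word (a :: w) = inv_word w ++ [:: inv_letter a].
  by rewrite /inv_word /= rev_cons cats1.
have -> : (a :: w) ++ inv_word w ++ [:: inv_letter a]
          = [:: a] ++ ((w ++ inv_word w) ++ [:: inv_letter a]).
  by rewrite /= catA.
apply: weq_trans (weq_cancel a).
apply: (@weq_cat P [:: a] [:: a] _ [:: inv_letter a]); first exact: weq_refl.
exact: (@weq_cat P _ [::] _ [:: inv_letter a]) IHw (weq_refl _).
Qed.

Lemma weq_Vmul w : weq P (inv_word w ++ w) [::].
Proof. by have := weq_mulV (inv_word w); rewrite inv_wordK. Qed.

Lemma weq_inv u v : weq P u v -> weq P (inv_word u) (inv_word v).
Proof.
move=> uv.
have uVv : weq P (inv_word u ++ v) [::].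
  apply: weq_trans (weq_Vmul u).
  by apply: weq_cat (weq_refl _) _; apply: weq_sym.
have h1 : weq P (inv_word u) (inv_word u ++ (v ++ inv_word v)).
  have := @weq_cat P _ _ _ _ (weq_refl (inv_word u)) (weq_sym (weq_mulV v)).
  by rewrite cats0.
apply: weq_trans h1 _; rewrite catA.
exact: (@weq_cat P _ [::]) uVv (weq_refl _).
Qed.

Definition pg_mul (x y : presented_group) : presented_group :=
  word_class (repr x ++ repr y).
Definition pg_one : presented_group := word_class [::].
Definition pg_inv (x : presented_group) : presented_group :=
  word_class (inv_word (repr x)).

Lemma pg_ind (K : presented_group -> Prop) :
  (forall w, K (word_class w)) -> forall x, K x.
Proof. by move=> Kw x; have := Kw (repr x); rewrite /word_class reprK. Qed.

Lemma pg_mulE u v : pg_mul (word_class u) (word_class v) = word_class (u ++ v).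
Proof. by apply/word_classP; apply: weq_cat; apply: weq_repr. Qed.

Lemma pg_invE u : pg_inv (word_class u) = word_class (inv_word u).
Proof. by apply/word_classP; apply: weq_inv; apply: weq_repr. Qed.

Lemma pg_mulA : associative pg_mul.
Proof.
elim/pg_ind=> u; elim/pg_ind=> v; elim/pg_ind=> w.
by rewrite !pg_mulE catA.
Qed.

Lemma pg_mul1 : left_id pg_one pg_mul.
Proof. by elim/pg_ind=> w; rewrite pg_mulE. Qed.

Lemma pg_mulr1 : right_id pg_one pg_mul.
Proof. by elim/pg_ind=> w; rewrite pg_mulE cats0. Qed.

Lemma pg_mulV : left_inverse pg_one pg_inv pg_mul.
Proof.
by elim/pg_ind=> w; rewrite pg_invE pg_mulE; apply/word_classP; apply: weq_Vmul.
Qed.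

Lemma pg_mulrV : right_inverse pg_one pg_inv pg_mul.
Proof.
by elim/pg_ind=> w; rewrite pg_invE pg_mulE; apply/word_classP; apply: weq_mulV.
Qed.

HB.instance Definition _ := isGroup.Build presented_group
  pg_mulA pg_mul1 pg_mulr1 pg_mulV pg_mulrV.

Lemma word_class_cat u v : word_class (u ++ v) = word_class u * word_class v.
Proof. exact/esym/pg_mulE. Qed.

Lemma word_class_nil : word_class [::] = 1.
Proof. by []. Qed.

Lemma word_class_inv u : word_class (inv_word u) = (word_class u)^-1.
Proof. exact/esym/pg_invE. Qed.

Definition pg_gen (i : 'I_(ngens P)) : presented_group :=
  word_class [:: (i, false)].

End PresentedGroup.

Definition presents (P : presentation) (G : groupType) : Prop :=
  exists f : {multiplicative presented_group P -> G}, bijective f.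

Definition normal_subgroup (G : groupType) (H : {pred G}) : Prop :=
  group_closed H /\ forall g h : G, h \in H -> g * h * g^-1 \in H.

Definition finitely_presented_subgroup (G : groupType) (H : {pred G}) : Prop :=
  exists (P : presentation) (f : {multiplicative presented_group P -> G}),
    injective f /\ forall h : G, h \in H <-> exists x, f x = h.

(* An isomorphism G/H -> Z, written as the map it induces on G: the equivalence
   says that it is well defined and injective on the cosets of H. *)
Definition quotient_isom_Z (G : groupType) (H : {pred G}) : Prop :=
  exists f : G -> int,
    [/\ forall x y, f x = f y <-> x^-1 * y \in H,
        forall x y, f (x * y) = (f x + f y)%R
      & forall m : int, exists x, f x = m].

Definition fp_by_Z (G : groupType) : Prop :=
  exists H : {pred G},
    [/\ normal_subgroup H, finitely_presented_subgroup H & quotient_isom_Z H].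

(* The data X = {x_0, ..., x_(sX - 1)}, R and alpha of an expression
   < X, t | R, t x t^-1 = alpha(x) (x in X) >. *)
Record standard_data := StandardData {
  sX : nat;
  sR : seq (word sX);
  salpha : 'I_sX -> word sX
}.

Arguments salpha : clear implicits.

Definition base_presentation (S : standard_data) : presentation :=
  Presentation (sR S).

(* The stable letter t is the last of the n + 1 generators. *)
Definition t_letter n : 'I_n.+1 * bool := (ord_max, false).

Definition lift_word n (w : word n) : word n.+1 :=
  [seq (lift ord_max a.1, a.2) | a <- w].

(* The relation t x_i t^-1 = w, as the relator t x_i t^-1 w^-1. *)
Definition conj_relator n (i : 'I_n) (w : word n) : word n.+1 :=
  [:: t_letter n; (lift ord_max i, false); inv_letter (t_letter n)]
    ++ inv_word (lift_word w).

Definition standard_form (S : standard_data) : presentation :=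
  @Presentation (sX S).+1
    (map (@lift_word (sX S)) (sR S)
       ++ [seq conj_relator i (salpha S i) | i <- enum 'I_(sX S)]).

Definition defines_automorphism (S : standard_data) : Prop :=
  let B := base_presentation S in
  exists phi : {multiplicative presented_group B -> presented_group B},
    bijective phi /\
    forall i : 'I_(sX S), phi (@pg_gen B i) = @word_class B (salpha S i).

Definition standard_presentation_for (S : standard_data) (G : groupType) : Prop :=
  defines_automorphism S /\ presents (standard_form S) G.

(* Programs for k-ary mu-recursive functions; as 'I_m is finite, the family g in
   RComp f g amounts to an m-tuple of programs. *)
Inductive recfun : nat -> Type :=
| RZero k : recfun k
| RSucc : recfun 1
| RProj k : 'I_k -> recfun k
| RComp k m : recfun m -> ('I_m -> recfun k) -> recfun k
| RPrec k : recfun k -> recfun k.+2 -> recfun k.+1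
| RMu k : recfun k.+1 -> recfun k.

(* h(0, v) = f(v) and h(n+1, v) = g(n, h(n, v), v), for graphs of partial
   functions. *)
Fixpoint prec_graph k (f : k.-tuple nat -> nat -> Prop)
    (g : k.+2.-tuple nat -> nat -> Prop) (n : nat) (v : k.-tuple nat) (y : nat) : Prop :=
  if n is m.+1 then
    exists z, prec_graph f g m v z /\ g [tuple of m :: z :: v] y
  else f v y.

(* [recfun_eval f v y]: f is defined at v, with value y. *)
Fixpoint recfun_eval k (f : recfun k) : k.-tuple nat -> nat -> Prop :=
  match f in recfun k return k.-tuple nat -> nat -> Prop with
  | RZero k => fun _ y => y = 0%N
  | RSucc => fun v y => y = (thead v).+1
  | RProj k i => fun v y => y = tnth v i
  | RComp k m f g => fun v y =>
      exists w : m.-tuple nat,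
        (forall i, recfun_eval (g i) v (tnth w i)) /\ recfun_eval f w y
  | RPrec k f g => fun v y =>
      prec_graph (recfun_eval f) (recfun_eval g) (thead v) (behead_tuple v) y
  | RMu k f => fun v y =>
      recfun_eval f [tuple of y :: v] 0%N /\
      forall m, (m < y)%N -> exists z, recfun_eval f [tuple of m :: v] z.+1
  end.

(* Domains of partial recursive functions. *)
Definition recursively_enumerable k (A : k.-tuple nat -> Prop) : Prop :=
  exists f : recfun k, forall v, A v <-> exists y, recfun_eval f v y.

(* [CodeSeq.code] is MathComp's bijection from seq nat to nat, with
   code [::] = 0 and code (n :: s) = 2 ^ n * (2 * code s + 1). *)

Definition letter_code n (a : 'I_n * bool) : nat := (a.2 + (val a.1).*2)%N.

Definition word_code n (w : word n) : nat :=
  CodeSeq.code (map (@letter_code n) w).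

Definition words_code n (ws : seq (word n)) : nat :=
  CodeSeq.code (map (@word_code n) ws).

Definition presentation_code (P : presentation) : nat :=
  CodeSeq.code [:: ngens P; words_code (relators P)].

Definition standard_code (S : standard_data) : nat :=
  CodeSeq.code
    [:: sX S; words_code (sR S); words_code [seq salpha S i | i <- enum 'I_(sX S)]].

Lemma letter_code_inj n : injective (@letter_code n).
Proof.
move=> [i b] [j c] /= e.
have ebc : b = c.
  by have := congr1 odd e; rewrite /letter_code /= !oddD !odd_double !addbF; case: b c {e} => [] [].
move: e; rewrite ebc /letter_code /= => /addnI /double_inj e.
by congr (_, _); apply: val_inj.
Qed.

Lemma word_code_inj n : injective (@word_code n).
Proof. by move=> u v /(can_inj CodeSeq.codeK) /(inj_map (@letter_code_inj n)). Qed.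

Lemma words_code_inj n : injective (@words_code n).
Proof. by move=> u v /(can_inj CodeSeq.codeK) /(inj_map (@word_code_inj n)). Qed.

Lemma presentation_code_inj : injective presentation_code.
Proof.
move=> [n R] [n' R'] /(can_inj CodeSeq.codeK) /= [en]; subst n'.
by move=> /words_code_inj ->.
Qed.

Lemma standard_code_inj : injective standard_code.
Proof.
move=> [n R f] [n' R' f'] /(can_inj CodeSeq.codeK) /= [en]; subst n'.
move=> /words_code_inj -> /words_code_inj /eq_in_map eff'.
by congr StandardData; apply/funext => i; apply: eff'; rewrite mem_enum.
Qed.

(* Main.v *)
Require Import Defs.
From HB Require Import structures.
From mathcomp Require Import all_boot.
From mathcomp Require Import boolp.

(** Whether data [S] form a standard presentation of the group of [P] is witnessed
    by finitely many words and finitely many finite derivations: words for an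
    inverse of [alpha] on the generators of the base group, words for mutually
    inverse homomorphisms between the groups of [P] and of [standard_form S], and
    a derivation for each of the finitely many equations saying that these
    assignments kill the relators and are inverse to each other. A search through
    all conceivable witnesses therefore halts exactly when [S] is a standard
    presentation, and the search is uniform in [P].

    The group theory is in [retractionsP]: an assignment [f] of words to generators
    extends to an isomorphism exactly when some [g] exists such that both respect
    the relators and both composites fix the generators, up to [weq]. Equality of
    words is turned into a search problem by [derivable]: a derivation is a list of
    explicit insertions and deletions of trivial words, and replaying such a list is
    a left fold.

    To show that the search is performed by a mu-recursive program, everything is
    phrased over lists of numbers, for which the countable-type encoding [pickle]
    agrees with [CodeSeq.code]. A function between countable types is [computable]
    when a total recursive function realises it on codes. Left folds over lists are
    computable ([computable_foldl]), and with them all the list operations used in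
    the formulas; a hint database then proves computability by following the syntax.
    A predicate is [semidecidable] when it asserts that some number passes a
    computable test; such predicates are closed under conjunction, quantification
    over the members of a list and existential quantification. The condition on
    [(P, S)] is assembled from these closure properties, and [semidecidable_re]
    performs the search by one unbounded minimisation. *)

Set Implicit Arguments.
Unset Strict Implicit.
Unset Printing Implicit Defensive.

(** * Total recursive functions *)

Definition total_recursive k (f : k.-tuple nat -> nat) : Prop :=
  exists F : recfun k, forall v y, recfun_eval F v y <-> y = f v.

Lemma eq_total_recursive k (f g : k.-tuple nat -> nat) :
  f =1 g -> total_recursive f -> total_recursive g.
Proof. by move=> fg [F FE]; exists F => v y; rewrite FE fg. Qed.

Lemma total_recursive_proj k (i : 'I_k) : total_recursive (fun v => tnth v i).
Proof. by exists (RProj i). Qed.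

Lemma total_recursive_comp k m (g : m.-tuple nat -> nat)
    (f : 'I_m -> k.-tuple nat -> nat) :
  total_recursive g -> (forall i, total_recursive (f i)) ->
  total_recursive (fun v => g [tuple f i v | i < m]).
Proof.
move=> [G GE] /fin_all_exists [F FE]; exists (RComp G F) => v y /=; split.
  case=> w [fw /GE ->]; congr g; apply: eq_from_tnth => i.
  by rewrite tnth_mktuple; apply/FE/fw.
move=> ->; exists [tuple f i v | i < m]; split; last exact/GE.
by move=> i; apply/FE; rewrite tnth_mktuple.
Qed.

Lemma total_recursive_comp1 k (g : nat -> nat) (f : k.-tuple nat -> nat) :
  total_recursive (fun w : 1.-tuple nat => g (thead w)) -> total_recursive f ->
  total_recursive (fun v => g (f v)).
Proof.
move=> rg rf; apply: eq_total_recursive (total_recursive_comp rg (fun=> rf)) => v.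
by rewrite /thead tnth_mktuple.
Qed.

Lemma total_recursive_const k c : total_recursive (fun _ : k.-tuple nat => c).
Proof.
elim: c => [|c IHc]; first by exists (RZero k).
apply: total_recursive_comp1 IHc; exact: (ex_intro _ RSucc).
Qed.

Lemma total_recursive_succ k (f : k.-tuple nat -> nat) :
  total_recursive f -> total_recursive (fun v => (f v).+1).
Proof. by apply: total_recursive_comp1; exists RSucc. Qed.

Lemma total_recursive_prec k (f : k.-tuple nat -> nat) (g : k.+2.-tuple nat -> nat) :
  total_recursive f -> total_recursive g ->
  total_recursive (fun v : k.+1.-tuple nat =>
    iteri (thead v) (fun m z => g [tuple of m :: z :: behead v]) (f (behead_tuple v))).
Proof.
move=> [F FE] [G GE]; exists (RPrec F G) => v /=.
have eg m z : [tuple of m :: z :: behead v] = [tuple of m :: z :: behead_tuple v].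
  exact: val_inj.
elim: (thead v) => [|n IHn] y /=; first exact: FE.
split=> [[z [/IHn -> /GE ->]] | ->]; first by rewrite eg.
by eexists; split; [apply/IHn | apply/GE; rewrite eg].
Qed.

(** The value of [n] is computed from the arguments rather than being one of
    them, so that recursion can be nested inside compositions. *)
Lemma total_recursive_iteri k (n f : k.-tuple nat -> nat)
    (g : nat -> nat -> k.-tuple nat -> nat) :
  total_recursive n -> total_recursive f ->
  total_recursive (fun w : k.+2.-tuple nat =>
     g (thead w) (thead (behead_tuple w)) (behead_tuple (behead_tuple w))) ->
  total_recursive (fun v => iteri (n v) (fun m z => g m z v) (f v)).
Proof.
move=> rn rf rg; pose h (i : 'I_k.+1) :=
  if unlift ord0 i is Some j then fun v : k.-tuple nat => tnth v j else n.
have rh i : total_recursive (h i).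
  by rewrite /h; case: unlift => [j|//]; apply: total_recursive_proj.
apply: eq_total_recursive (total_recursive_comp (total_recursive_prec rf rg) rh) => v.
have -> : [tuple h i v | i < k.+1] = [tuple of n v :: v].
  apply: eq_from_tnth => i; rewrite tnth_mktuple /h.
  case: unliftP => [j|] -> /=; first by rewrite tnthS.
  by rewrite tnth0.
rewrite theadE; congr iteri; last by congr f; apply: val_inj.
apply/funext => m; apply/funext => z /=.
by congr (g _ _ _); apply: val_inj.
Qed.

Lemma total_recursive_thead k : total_recursive (fun v : k.+1.-tuple nat => thead v).
Proof. exact: total_recursive_proj. Qed.

Lemma total_recursive_behead k (f : k.-tuple nat -> nat) :
  total_recursive f -> total_recursive (fun v : k.+1.-tuple nat => f (behead_tuple v)).
Proof.
move=> rf; pose p i (v : k.+1.-tuple nat) := tnth v (lift ord0 i).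
have rp i : total_recursive (p i) by apply: total_recursive_proj.
apply: eq_total_recursive (total_recursive_comp rf rp) => v; congr f.
apply: eq_from_tnth => i; rewrite tnth_mktuple tnth_behead /p; congr tnth.
by apply: val_inj; rewrite /= inordK // ltnS.
Qed.

Lemma total_recursive_add k (f g : k.-tuple nat -> nat) :
  total_recursive f -> total_recursive g -> total_recursive (fun v => f v + g v).
Proof.
move=> rf rg.
apply: (@eq_total_recursive _ (fun v => iteri (g v) (fun _ z => z.+1) (f v))).
  by move=> v; elim: (g v) => [|n /= ->]; rewrite ?addn0 ?addnS.
apply: total_recursive_iteri => //; apply: total_recursive_succ.
exact: total_recursive_behead (total_recursive_thead _).
Qed.

Lemma total_recursive_eq0 k (f : k.-tuple nat -> nat) :
  total_recursive f -> total_recursive (fun v => f v == 0 : nat).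
Proof.
move=> rf; apply: (@eq_total_recursive _ (fun v => iteri (f v) (fun _ _ => 0) 1)).
  by move=> v; case: (f v).
by apply: total_recursive_iteri => //; apply: total_recursive_const.
Qed.

Lemma total_recursive_if0 k (c f g : k.-tuple nat -> nat) :
  total_recursive c -> total_recursive f -> total_recursive g ->
  total_recursive (fun v => if c v == 0 then f v else g v).
Proof.
move=> rc rf rg.
apply: (@eq_total_recursive _ (fun v => iteri (c v) (fun _ _ => g v) (f v))).
  by move=> v; case: (c v).
by apply: total_recursive_iteri => //; exact: total_recursive_behead (total_recursive_behead rg).
Qed.

Lemma total_recursive_odd k (f : k.-tuple nat -> nat) :
  total_recursive f -> total_recursive (fun v => odd (f v) : nat).
Proof.
move=> rf; apply: (@eq_total_recursive _ (fun v => iteri (f v) (fun _ b => b == 0) 0)).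
  by move=> v; elim: (f v) => [|n /= ->] //; case: odd.
apply: total_recursive_iteri => //; first exact: total_recursive_const.
exact: total_recursive_eq0 (total_recursive_behead (total_recursive_thead _)).
Qed.

Lemma total_recursive_half k (f : k.-tuple nat -> nat) :
  total_recursive f -> total_recursive (fun v => (f v)./2).
Proof.
move=> rf; apply: (@eq_total_recursive _ (fun v => iteri (f v) (fun m z => odd m + z) 0)).
  by move=> v; elim: (f v) => [|n /= ->] //; rewrite uphalf_half.
apply: total_recursive_iteri => //; first exact: total_recursive_const.
apply: total_recursive_add; first exact: total_recursive_odd (total_recursive_thead _).
exact: total_recursive_behead (total_recursive_thead _).
Qed.

(** * Lists of numbers as numbers *)

(** [CodeSeq.code] makes every natural number a list of natural numbers; the
    head of that list is the exponent of 2 in the number. *)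
Definition ncons x c := 2 ^ x * c.*2.+1.
Definition nhead c := head 0 (CodeSeq.decode c).
Definition ntail c := CodeSeq.code (behead (CodeSeq.decode c)).

Lemma nhead_code s : nhead (CodeSeq.code s) = head 0 s.
Proof. by rewrite /nhead CodeSeq.codeK. Qed.

Lemma ntail_code s : ntail (CodeSeq.code s) = CodeSeq.code (behead s).
Proof. by rewrite /ntail CodeSeq.codeK. Qed.

Lemma code_eq0 s : (CodeSeq.code s == 0) = nilp s.
Proof. by case: s => [|x s] //=; rewrite muln_eq0 expn_eq0. Qed.

Lemma size_code s : size s <= CodeSeq.code s.
Proof.
elim: s => //= x s IHs; apply: leq_trans (leq_pmull _ _); last by rewrite expn_gt0.
by rewrite ltnS -addnn (leq_trans IHs) ?leq_addr.
Qed.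

(** Halving strips the powers of 2 one at a time, which is how the head of a list
    is read off its code. *)
Lemma iter_half x n m : x <= n -> iter x half (2 ^ n * m) = 2 ^ (n - x) * m.
Proof.
elim: x => [|x IHx] lt_xn; rewrite ?subn0 //= IHx 1?ltnW //.
rewrite subnS; move: lt_xn; rewrite -subn_gt0; case: (n - x) => //= d _.
by rewrite expnS -mulnA mul2n doubleK.
Qed.

Lemma total_recursive_ncons k (f g : k.-tuple nat -> nat) :
  total_recursive f -> total_recursive g -> total_recursive (fun v => ncons (f v) (g v)).
Proof.
move=> rf rg.
apply: (@eq_total_recursive _ (fun v => iteri (f v) (fun _ z => z + z) (g v + g v).+1)).
  move=> v; rewrite addnn /ncons; elim: (f v) => [|n /= ->]; first by rewrite mul1n.
  by rewrite addnn -mul2n mulnA -expnS.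
apply: total_recursive_iteri => //.
  by apply: total_recursive_succ; apply: total_recursive_add.
by apply: total_recursive_add; apply: total_recursive_behead; apply: total_recursive_thead.
Qed.

Lemma total_recursive_iter_half k (f g : k.-tuple nat -> nat) :
  total_recursive f -> total_recursive g ->
  total_recursive (fun v => iter (f v) half (g v)).
Proof.
move=> rf rg; apply: (@eq_total_recursive _ (fun v => iteri (f v) (fun _ => half) (g v))).
  by move=> v; elim: (f v) => //= n ->.
apply: total_recursive_iteri => //; apply: total_recursive_half.
exact: total_recursive_behead (total_recursive_thead _).
Qed.

(** The head of a nonempty list is found by minimisation: it is the first [x] such
    that halving [x] times gives an odd number. The summand [c == 0] makes the
    search stop at once on the empty list, so that the function is total. *)
Lemma total_recursive_nhead k (f : k.-tuple nat -> nat) :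
  total_recursive f -> total_recursive (fun v => nhead (f v)).
Proof.
apply: total_recursive_comp1.
pose t (w : 2.-tuple nat) : nat :=
  (odd (iter (thead w) half (thead (behead_tuple w))) + (thead (behead_tuple w) == 0) == 0).
have [T TE]: total_recursive t.
  have rx := total_recursive_thead 1.
  have rc := total_recursive_behead (total_recursive_thead 0).
  apply/total_recursive_eq0/total_recursive_add; last exact: total_recursive_eq0.
  exact/total_recursive_odd/total_recursive_iter_half.
have tE x (v : 1.-tuple nat) :
    t [tuple of x :: v] = (odd (iter x half (thead v)) + (thead v == 0) == 0).
  rewrite /t theadE; have -> // : behead_tuple [tuple of x :: v] = v.
  exact: val_inj.
exists (RMu T) => v y /=; set c := thead v.
have t_lt x : x < nhead c -> t [tuple of x :: v] = 1.
  rewrite tE -/c -[c]CodeSeq.decodeK nhead_code.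
  case: (CodeSeq.decode c) => [|n s] //= lt_xn.
  rewrite iter_half 1?ltnW // muln_eq0 expn_eq0 /= addn0.
  move: lt_xn; rewrite -subn_gt0; case: (n - x) => // d _.
  by rewrite expnS -mulnA mul2n odd_double.
have t_eq : t [tuple of nhead c :: v] = 0.
  rewrite tE -/c -[c]CodeSeq.decodeK nhead_code.
  case: (CodeSeq.decode c) => [|n s] //=.
  by rewrite iter_half // subnn mul1n /= odd_double.
split=> [[/TE t0 tS]|->].
  case: (ltngtP y (nhead c)) => // [lt_yc|/tS[z /TE]].
    by rewrite t_lt in t0.
  by rewrite t_eq.
split; first by apply/TE.
by move=> x lt_x; exists 0; apply/TE; rewrite t_lt.
Qed.

Lemma total_recursive_ntail k (f : k.-tuple nat -> nat) :
  total_recursive f -> total_recursive (fun v => ntail (f v)).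
Proof.
move=> rf; apply: (@eq_total_recursive _ (fun v => (iter (nhead (f v)) half (f v))./2)).
  move=> v; rewrite -[f v]CodeSeq.decodeK ntail_code nhead_code.
  case: (CodeSeq.decode (f v)) => //= n s.
  by rewrite iter_half // subnn mul1n /= uphalf_double.
by apply/total_recursive_half/total_recursive_iter_half => //; apply: total_recursive_nhead.
Qed.

(** * Computable functions between countable types *)

(** Realisers are specified on codes only: their values at the numbers that encode
    no element of [A] are arbitrary. *)
Definition computable (A B : countType) (f : A -> B) : Prop :=
  exists F : nat -> nat, total_recursive (fun v : 1.-tuple nat => F (thead v)) /\
    forall a, F (pickle a) = pickle (f a).

(* The database follows the syntax of the function; with opaque constants no
   definition is unfolded when a rule is selected. *)
Create HintDb computable discriminated.
#[local] Hint Constants Opaque : computable.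

Ltac compute_by := solve [eauto 100 with computable nocore].

Section Basic.
Variables E A B : countType.

Lemma eq_computable (f g : E -> A) : f =1 g -> computable f -> computable g.
Proof. by move=> fg [F [rF FE]]; exists F; split=> // a; rewrite FE fg. Qed.

Lemma computable_const (c : A) : computable (fun _ : E => c).
Proof. by exists (fun=> pickle c); split=> //; apply: total_recursive_const. Qed.

Lemma computable_id : computable (fun e : E => e).
Proof. by exists id; split=> //; apply: total_recursive_thead. Qed.

Lemma computable_comp (g : A -> B) (f : E -> A) :
  computable g -> computable f -> computable (fun e => g (f e)).
Proof.
move=> [G [rG GE]] [F [rF FE]]; exists (G \o F); split=> [|a]; last by rewrite /= FE GE.
exact: total_recursive_comp1 rG rF.
Qed.

Lemma computable_pair (f : E -> A) (g : E -> B) :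
  computable f -> computable g -> computable (fun e => (f e, g e)).
Proof.
move=> [F [rF FE]] [G [rG GE]]; exists (fun x => ncons (F x) (ncons (G x) 0)).
split=> [|e]; last by rewrite FE GE.
apply: total_recursive_ncons => //; apply: total_recursive_ncons => //.
exact: total_recursive_const.
Qed.

Lemma computable_fst (f : E -> A * B) : computable f -> computable (fun e => (f e).1).
Proof.
move=> [F [rF FE]]; exists (nhead \o F).
split=> [|e]; first exact: total_recursive_nhead.
by rewrite /= FE; case: (f e) => a b; apply: (nhead_code [:: _; _]).
Qed.

Lemma computable_snd (f : E -> A * B) : computable f -> computable (fun e => (f e).2).
Proof.
move=> [F [rF FE]]; exists (nhead \o ntail \o F).
split=> [|e]; first by apply: total_recursive_nhead; apply: total_recursive_ntail.
rewrite /= FE; case: (f e) => a b; rewrite (ntail_code [:: _; _]).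
exact: (nhead_code [:: _]).
Qed.

(** Since [pickle] is the identity on numbers, a realiser of [f] also realises the
    function that returns the code of [f e]; this gives access to codes inside
    computable definitions, for instance to bound the length of a list. *)
Lemma computable_pickle (f : E -> A) : computable f -> computable (fun e => pickle (f e)).
Proof. by case=> F FE; exists F. Qed.

Lemma computable_succ (n : E -> nat) : computable n -> computable (fun e => (n e).+1).
Proof.
move=> [N [rN NE]]; exists (fun x => (N x).+1); split=> [|e]; last by rewrite NE.
exact: total_recursive_succ.
Qed.

Lemma computable_odd (n : E -> nat) : computable n -> computable (fun e => odd (n e)).
Proof.
move=> [N [rN NE]]; exists (fun x => odd (N x) : nat); split=> [|e]; last by rewrite NE.
exact: total_recursive_odd.
Qed.

Lemma computable_half (n : E -> nat) : computable n -> computable (fun e => (n e)./2).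
Proof.
move=> [N [rN NE]]; exists (fun x => (N x)./2); split=> [|e]; last by rewrite NE.
exact: total_recursive_half.
Qed.

Lemma computable_cons (x : E -> A) (s : E -> seq A) :
  computable x -> computable s -> computable (fun e => x e :: s e).
Proof.
move=> [X [rX XE]] [S [rS SE]]; exists (fun x => ncons (X x) (S x)).
split=> [|e]; last by rewrite XE SE.
exact: total_recursive_ncons.
Qed.

Lemma computable_case_seq (s : E -> seq A) (f : E -> B) (g : E -> A -> seq A -> B) :
  computable s -> computable f ->
  computable (fun p : E * (A * seq A) => g p.1 p.2.1 p.2.2) ->
  computable (fun e => if s e is x :: s' then g e x s' else f e).
Proof.
move=> [S [rS SE]] [F [rF FE]] [G [rG GE]].
pose p x := ncons x (ncons (ncons (nhead (S x)) (ncons (ntail (S x)) 0)) 0).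
exists (fun x => if S x == 0 then F x else G (p x)); split=> [|e].
  apply: total_recursive_if0 => //; apply: (total_recursive_comp1 rG).
  have r0 := @total_recursive_const 1 0.
  apply: total_recursive_ncons; first exact: total_recursive_thead.
  apply: total_recursive_ncons => //; apply: total_recursive_ncons.
    exact: total_recursive_nhead.
  by apply: total_recursive_ncons => //; apply: total_recursive_ntail.
rewrite /p SE (code_eq0 (map pickle (s e))) nhead_code ntail_code.
by case: (s e) => [|x s'] /=; rewrite ?FE // -[RHS](GE (e, (x, s'))).
Qed.

(** The body [h] may use the environment [e]: binders are interpreted by pairing the
    environment with the bound variable, here and in the rules below. *)
Lemma computable_iter (n : E -> nat) (h : E -> A -> A) (b : E -> A) :
  computable n -> computable (fun p : E * A => h p.1 p.2) -> computable b ->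
  computable (fun e => iter (n e) (h e) (b e)).
Proof.
move=> [N [rN NE]] [H [rH HE]] [G [rG GE]].
exists (fun x => iteri (N x) (fun _ z => H (ncons x (ncons z 0))) (G x)); split=> [|e].
  apply: total_recursive_iteri => //; apply: (total_recursive_comp1 rH).
  apply: total_recursive_ncons.
    exact: total_recursive_behead (total_recursive_behead (total_recursive_thead _)).
  apply: total_recursive_ncons; last exact: total_recursive_const.
  exact: total_recursive_behead (total_recursive_thead _).
by rewrite NE GE; elim: (n e) => //= k ->; rewrite -[RHS](HE (e, _)).
Qed.

End Basic.

#[local] Hint Resolve computable_const computable_id computable_pair computable_fst
  computable_snd computable_pickle computable_succ computable_odd computable_half
  computable_cons computable_case_seq computable_iter : computable.

(* A function that is computable by hypothesis may occur in a larger context than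
   the one in which the hypothesis speaks of it. *)
#[local] Hint Extern 5 (computable (fun e => ?f (@?g e))) =>
  match goal with cf : computable f |- _ => apply: (computable_comp cf) end : computable.

Section Naturals.
Variable E : countType.
Implicit Types (b : E -> bool) (m n : E -> nat).

Lemma computable_if (A : countType) b (f g : E -> A) :
  computable b -> computable f -> computable g ->
  computable (fun e => if b e then f e else g e).
Proof.
move=> cb cf cg.
apply: (@eq_computable _ _ (fun e => iter (b e) (fun _ => f e) (g e))); last by compute_by.
by move=> e; case: (b e).
Qed.

Lemma computable_and b1 b2 :
  computable b1 -> computable b2 -> computable (fun e => b1 e && b2 e).
Proof.
move=> cb1 cb2; apply: (@eq_computable _ _ (fun e => if b1 e then b2 e else false)).
  by move=> e; case: (b1 e).
by apply: computable_if => //; compute_by.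
Qed.

Lemma computable_or b1 b2 :
  computable b1 -> computable b2 -> computable (fun e => b1 e || b2 e).
Proof.
move=> cb1 cb2; apply: (@eq_computable _ _ (fun e => if b1 e then true else b2 e)).
  by move=> e; case: (b1 e).
by apply: computable_if => //; compute_by.
Qed.

Lemma computable_pred n : computable n -> computable (fun e => (n e).-1).
Proof.
move=> cn.
apply: (@eq_computable _ _ (fun e => (iter (n e) (fun p => (p.2, p.2.+1)) (0, 0)).1)).
  (* Along the iteration the second component runs one step ahead of the first. *)
  move=> e; rewrite -[in RHS](_ : (iter (n e) (fun p => (p.2, p.2.+1)) (0, 0)).2 = n e).
    by case: (n e).
  by elim: (n e) => //= k ->.
by compute_by.
Qed.

Lemma computable_double n : computable n -> computable (fun e => (n e).*2).
Proof.
move=> cn; apply: (@eq_computable _ _ (fun e => iter (n e) (fun k => k.+2) 0)).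
  by move=> e; elim: (n e) => //= k ->.
by compute_by.
Qed.

End Naturals.
#[local] Hint Resolve computable_if computable_and computable_or
  computable_pred computable_double : computable.

Section Comparisons.
Variable E : countType.
Implicit Types (m n : E -> nat).

Lemma computable_sub m n : computable m -> computable n -> computable (fun e => m e - n e).
Proof.
move=> cm cn; apply: (@eq_computable _ _ (fun e => iter (n e) predn (m e))).
  by move=> e; rewrite /=; elim: (n e) => [|k /= ->]; rewrite ?subn0 ?subnS.
by compute_by.
Qed.

Lemma computable_leq m n : computable m -> computable n -> computable (fun e => m e <= n e).
Proof.
move=> cm cn; have cmn := computable_sub cm cn.
apply: (@eq_computable _ _ (fun e => iter (m e - n e) (fun _ => false) true)).
  by move=> e; rewrite /leq; case: (m e - n e).
by compute_by.
Qed.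

Lemma computable_eq (A : countType) (x y : E -> A) :
  computable x -> computable y -> computable (fun e => x e == y e).
Proof.
move=> cx cy; apply: (@eq_computable _ _
    (fun e => (pickle (x e) <= pickle (y e)) && (pickle (y e) <= pickle (x e)))).
  by move=> e; rewrite -eqn_leq (inj_eq (pcan_inj pickleK)).
by apply: computable_and; apply: computable_leq; compute_by.
Qed.

End Comparisons.

#[local] Hint Resolve computable_leq : computable.
(* Full unification is needed to find the countable type that carries [==]. *)
#[local] Hint Extern 3 (computable (fun e => _ == _)) =>
  apply: computable_eq : computable.

Section Sequences.
Variables E A B : countType.
Implicit Types (s : E -> seq A).

(** A list is at most as long as its code, which therefore bounds the number of
    steps needed to consume it. *)
Lemma computable_foldl (f : E -> B -> A -> B) (b : E -> B) s :
  computable (fun p : E * (B * A) => f p.1 p.2.1 p.2.2) -> computable b -> computable s ->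
  computable (fun e => foldl (f e) (b e) (s e)).
Proof.
move=> cf cb cs; pose step e (p : B * seq A) :=
  if p.2 is x :: s' then (f e p.1 x, s') else p.
have stepE e k x t : size t <= k ->
    iter k (step e) (x, t) = (foldl (f e) x t, [::]).
  elim: k x t => [|k IHk] x [|a t] //=; rewrite -?iterS ?iterSr /=; last exact: IHk.
  by rewrite IHk.
apply: (@eq_computable _ _ (fun e => (iter (pickle (s e)) (step e) (b e, s e)).1)).
  by move=> e; rewrite stepE // -(size_map pickle) size_code.
apply: computable_fst; apply: computable_iter; [by compute_by | | by compute_by].
apply: computable_case_seq; [by compute_by..|].
apply: computable_pair; last by compute_by.
apply: (@computable_comp _ _ _ (fun p : E * (B * A) => f p.1 p.2.1 p.2.2)
  (fun p : E * (B * seq A) * (A * seq A) => (p.1.1, (p.1.2.1, p.2.1)))) => //.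
by compute_by.
Qed.

End Sequences.

#[local] Hint Resolve computable_foldl : computable.

Section MoreSequences.
Variables E A B : countType.
Implicit Types (s t : E -> seq A).

Lemma computable_catrev s t :
  computable s -> computable t -> computable (fun e => catrev (s e) (t e)).
Proof.
move=> cs ct.
apply: (@eq_computable _ _ (fun e => foldl (fun r x => x :: r) (t e) (s e))).
  by move=> e; elim: (s e) (t e) => //= x r IHr u; apply: IHr.
by compute_by.
Qed.

Lemma computable_rev s : computable s -> computable (fun e => rev (s e)).
Proof. by move=> cs; apply: (computable_catrev cs (computable_const _ [::])). Qed.

Lemma computable_foldr (f : E -> A -> B -> B) (b : E -> B) s :
  computable (fun p : E * (A * B) => f p.1 p.2.1 p.2.2) -> computable b -> computable s ->
  computable (fun e => foldr (f e) (b e) (s e)).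
Proof.
move=> cf cb cs.
apply: (@eq_computable _ _ (fun e => foldl (fun z x => f e x z) (b e) (rev (s e)))).
  by move=> e; rewrite foldl_rev.
apply: computable_foldl => //; last exact: computable_rev.
apply: (@computable_comp _ _ _ (fun p : E * (A * B) => f p.1 p.2.1 p.2.2)
  (fun p : E * (B * A) => (p.1, (p.2.2, p.2.1)))) => //.
by compute_by.
Qed.

End MoreSequences.
#[local] Hint Resolve computable_rev computable_foldr : computable.

Section Combinators.
Variables E A B : countType.
Implicit Types (s t : E -> seq A).

Lemma computable_cat s t :
  computable s -> computable t -> computable (fun e => s e ++ t e).
Proof.
move=> cs ct; apply: (@eq_computable _ _ (fun e => foldr cons (t e) (s e))).
  by move=> e; elim: (s e) => //= x r ->.
by compute_by.
Qed.

Lemma computable_map (f : E -> A -> B) s :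
  computable (fun p : E * A => f p.1 p.2) -> computable s ->
  computable (fun e => map (f e) (s e)).
Proof.
move=> cf cs; apply: (@eq_computable _ _ (fun e => foldr (fun x z => f e x :: z) [::] (s e))).
  by move=> e; elim: (s e) => //= x r ->.
apply: computable_foldr => //; last by compute_by.
apply: computable_cons; last by compute_by.
apply: (computable_comp cf (f := fun p : E * (A * seq B) => (p.1, p.2.1))).
by compute_by.
Qed.

End Combinators.

#[local] Hint Resolve computable_cat computable_map : computable.

Section Queries.
Variables E A : countType.
Implicit Types (s : E -> seq A) (p : E -> A -> bool).

Lemma computable_has p s :
  computable (fun q : E * A => p q.1 q.2) -> computable s ->
  computable (fun e => has (p e) (s e)).
Proof.
move=> cp cs; apply: (@eq_computable _ _ (fun e => foldr orb false (map (p e) (s e)))).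
  by move=> e; elim: (s e) => //= x r ->.
by compute_by.
Qed.

Lemma computable_all p s :
  computable (fun q : E * A => p q.1 q.2) -> computable s ->
  computable (fun e => all (p e) (s e)).
Proof.
move=> cp cs; apply: (@eq_computable _ _ (fun e => foldr andb true (map (p e) (s e)))).
  by move=> e; elim: (s e) => //= x r ->.
by compute_by.
Qed.

Lemma computable_nth (x0 : A) s (n : E -> nat) :
  computable s -> computable n -> computable (fun e => nth x0 (s e) (n e)).
Proof.
move=> cs cn; apply: (@eq_computable _ _
   (fun e => head x0 (iter (n e) behead (s e)))).
  move=> e; suff -> : iter (n e) behead (s e) = drop (n e) (s e).
    by rewrite -nth0 nth_drop addn0.
  by elim: (n e) => [|k /= ->]; rewrite ?drop0 // -drop1 drop_drop.
apply: computable_case_seq; [|by compute_by..].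
apply: computable_iter => //; apply: computable_case_seq; by compute_by.
Qed.

Lemma computable_size s : computable s -> computable (fun e => size (s e)).
Proof.
move=> cs; apply: (@eq_computable _ _ (fun e => foldr (fun _ n => n.+1) 0 (s e))).
  by move=> e; elim: (s e) => //= x r ->.
by compute_by.
Qed.

Lemma computable_mem (x : E -> A) s :
  computable x -> computable s -> computable (fun e => x e \in s e).
Proof.
move=> cx cs; apply: (@eq_computable _ _ (fun e => has (fun y => y == x e) (s e))).
  by move=> e; rewrite has_pred1.
by apply: computable_has => //; compute_by.
Qed.

End Queries.

#[local] Hint Resolve computable_has computable_all
  computable_nth computable_size computable_mem : computable.

Lemma computable_head (E A : countType) (x : A) (s : E -> seq A) :
  computable s -> computable (fun e => head x (s e)).
Proof.
by move=> cs; apply: (computable_case_seq (f := fun=> x) (g := fun _ y _ => y) cs); compute_by.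
Qed.
#[local] Hint Resolve computable_head : computable.

Lemma computable_flatten (E A : countType) (s : E -> seq (seq A)) :
  computable s -> computable (fun e => flatten (s e)).
Proof. by move=> cs; apply: computable_foldr; compute_by. Qed.

Lemma computable_iota0 (E : countType) (n : E -> nat) :
  computable n -> computable (fun e => iota 0 (n e)).
Proof.
move=> cn; apply: (@eq_computable _ _ (fun e => iter (n e) (fun s => s ++ [:: size s]) [::])).
  by move=> e; elim: (n e) => // k IHk; rewrite iterS IHk size_iota -[in RHS]addn1 iotaD.
by compute_by.
Qed.

#[local] Hint Resolve computable_flatten computable_iota0 : computable.

(** * Semidecidable predicates *)

Definition semidecidable (E : countType) (A : E -> Prop) : Prop :=
  exists D : E * nat -> bool, computable D /\ forall e, A e <-> exists n, D (e, n).

(** A surjection from the numbers is easier to have than a decision procedure for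
    the image of [pickle], and it is enough to search through [T]. *)
Definition enumerable (T : countType) : Prop :=
  exists d : nat -> T, computable d /\ forall t, exists n, d n = t.

(** Replacing the test at [n] by a bounded search up to [n] makes it monotone, so
    that the finitely many witnesses required by a conjunction or by the members of
    a list can be replaced by their maximum. *)
Lemma semidecidable_monotone (E : countType) (A : E -> Prop) :
  semidecidable A ->
  exists D : E * nat -> bool,
    [/\ computable D, forall e m n, m <= n -> D (e, m) -> D (e, n)
      & forall e, A e <-> exists n, D (e, n)].
Proof.
move=> [D [cD DE]]; exists (fun p => has (fun m => D (p.1, m)) (iota 0 p.2)).
split=> [|e m n le_mn /= /hasP[x]|e]; first by compute_by.
  rewrite mem_iota add0n => lt_xm Dx; apply/hasP; exists x => //.
  by rewrite mem_iota add0n (leq_trans lt_xm).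
split=> [/DE[n Dn] | [n /hasP[m _ Dm]]]; last by apply/DE; exists m.
by exists n.+1; apply/hasP; exists n; rewrite // mem_iota leqnn.
Qed.

Section Semidecidable.
Variable E : countType.
Implicit Types (A B : E -> Prop).

Lemma eq_semidecidable A B : (forall e, A e <-> B e) -> semidecidable A -> semidecidable B.
Proof. by move=> AB [D [cD DE]]; exists D; split=> // e; rewrite -AB. Qed.

Lemma semidecidable_computable (b : E -> bool) : computable b -> semidecidable b.
Proof.
move=> cb; exists (fun p => b p.1); split; first by compute_by.
by move=> e; split=> [be|[]]; first by exists 0.
Qed.

Lemma semidecidable_and A B :
  semidecidable A -> semidecidable B -> semidecidable (fun e => A e /\ B e).
Proof.
move=> /semidecidable_monotone[D [cD mD DE]] /semidecidable_monotone[C [cC mC CE]].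
exists (fun p => D p && C p); split=> [|e]; first by compute_by.
rewrite DE CE; split=> [[[m Dm] [n Cn]]|[n /andP[Dn Cn]]]; last by split; exists n.
exists (maxn m n); apply/andP.
by split; [apply: mD Dm; apply: leq_maxl | apply: mC Cn; apply: leq_maxr].
Qed.

Lemma semidecidable_all (T : countType) (s : E -> seq T) (A : E -> T -> Prop) :
  computable s -> semidecidable (fun p : E * T => A p.1 p.2) ->
  semidecidable (fun e => forall x, x \in s e -> A e x).
Proof.
move=> cs /semidecidable_monotone[D [cD mD DE]].
exists (fun p => all (fun x => D ((p.1, x), p.2)) (s p.1)); split=> [|e].
  by apply: computable_all; [apply: (computable_comp cD)|]; compute_by.
have {}DE x : A e x <-> exists n, D (e, x, n) by apply: (DE (e, x)).
split=> /= [|[n /allP Dn] x /Dn Dx]; last by apply/DE; exists n.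
elim: (s e) => [|x r IHr] Ar /=; first by exists 0.
have /DE[m Dm] := Ar x (mem_head x r).
have [y ry|n Dn] := IHr; first by apply: Ar; rewrite inE ry orbT.
exists (maxn m n); apply/andP; split; first by apply: mD Dm; apply: leq_maxl.
by apply: sub_all Dn => y; apply: mD; apply: leq_maxr.
Qed.

(** Both the index of [x] and the witness for [A e x] are searched below a common
    bound. *)
Lemma semidecidable_ex (T : countType) (A : E -> T -> Prop) :
  enumerable T -> semidecidable (fun p : E * T => A p.1 p.2) ->
  semidecidable (fun e => exists x, A e x).
Proof.
move=> [d [cd dT]] /semidecidable_monotone[D [cD mD DE]].
exists (fun p => has (fun n => D ((p.1, d n), p.2)) (iota 0 p.2)); split=> [|e].
  by apply: computable_has; [apply: (computable_comp cD)|]; compute_by.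
split=> /= [[x]|[n /hasP[m _ Dm]]]; last first.
  by exists (d m); apply/(DE (e, d m)); exists n.
have [m <-] := dT x; move=> /(DE (e, d m))[n Dn].
exists (maxn m.+1 n); apply/hasP; exists m; first by rewrite mem_iota leq_max ltnSn.
by apply: mD Dn; apply: leq_maxr.
Qed.

End Semidecidable.

Lemma computable_decode : computable CodeSeq.decode.
Proof.
exists id; split=> [|n]; first exact: total_recursive_thead.
transitivity (CodeSeq.code (map id (CodeSeq.decode n))) => //.
by rewrite map_id CodeSeq.decodeK.
Qed.

#[local] Hint Resolve computable_decode : computable.
#[local] Hint Extern 4 (computable (fun e => CodeSeq.decode _)) =>
  apply: (computable_comp computable_decode) : computable.

Lemma computable_code (E : countType) (s : E -> seq nat) :
  computable s -> computable (fun e => CodeSeq.code (s e)).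
Proof.
apply: computable_comp; exists id; split=> [|r]; first exact: total_recursive_thead.
by rewrite -[LHS]/(CodeSeq.code (map id r)) map_id.
Qed.
#[local] Hint Resolve computable_code : computable.

Lemma enumerable_nat : enumerable nat.
Proof. by exists id; split=> [|n]; [compute_by | exists n]. Qed.

Lemma enumerable_seq (T : countType) : enumerable T -> enumerable (seq T).
Proof.
move=> [d [cd dT]]; exists (fun n => map d (CodeSeq.decode n)); split=> [|s].
  (* The expected type inserts a coercion that hides the list type from the hints. *)
  by rewrite /reverse_coercion; compute_by.
suff [r <-] : exists r, map d r = s by exists (CodeSeq.code r); rewrite CodeSeq.codeK.
elim: s => [|x s [r <-]]; first by exists [::].
by have [n <-] := dT x; exists (n :: r).
Qed.

Lemma enumerable_prod (A B : countType) : enumerable A -> enumerable B -> enumerable (A * B)%type.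
Proof.
move=> [f [cf fA]] [g [cg gB]].
exists (fun n => (f (nth 0 (CodeSeq.decode n) 0), g (nth 0 (CodeSeq.decode n) 1))).
split=> [|[a b]].
  by rewrite /reverse_coercion; compute_by.
have [m <-] := fA a; have [n <-] := gB b.
by exists (CodeSeq.code [:: m; n]); rewrite CodeSeq.codeK.
Qed.

Lemma semidecidable_re (A : nat * nat -> Prop) :
  semidecidable A ->
  recursively_enumerable (fun v : 2.-tuple nat => A (tnth v ord0, tnth v ord_max)).
Proof.
move=> [D [[F [rF FE]] DE]].
have [T TE] : total_recursive (fun v : 3.-tuple nat =>
    F (ncons (ncons (tnth v (@Ordinal 3 1 isT)) (ncons (tnth v (@Ordinal 3 2 isT)) 0))
         (ncons (tnth v ord0) 0)) == 0 : nat).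
  apply: total_recursive_eq0; apply: (total_recursive_comp1 rF).
  by do ![apply: total_recursive_ncons | apply: total_recursive_proj
         | apply: total_recursive_const].
have {}TE n (v : 2.-tuple nat) y : recfun_eval T [tuple of n :: v] y <->
    y = ~~ D ((tnth v ord0, tnth v ord_max), n).
  have := FE (tnth v ord0, tnth v ord_max, n); rewrite TE !(tnth_nth 0) /= => ->.
  by case: (D _).
exists (RMu T) => v; rewrite DE; split=> [Dv|[n [/TE Dn _]]]; last first.
  by exists n; case: (D _) Dn.
case: (ex_minnP Dv) => n Dn n_min; exists n; split; first by apply/TE; rewrite Dn.
move=> m lt_mn; exists 0; apply/TE.
by case Dm: (D _) => //; rewrite ltnNge n_min in lt_mn.
Qed.

(** * Words as lists of numbers *)

Definition code_inv c := if odd c then c.-1 else c.+1.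
Definition codes_inv w := rev (map code_inv w).

(** [raw] forgets the number of generators; [parse] recovers a word over [n]
    generators from any list of numbers by skipping those that are not codes of
    letters. As [parse] commutes with concatenation, inversion and substitution,
    derivations and substitutions among unconstrained lists of numbers project to
    derivations and substitutions of words. *)
Definition raw n (w : word n) : seq nat := map (@letter_code n) w.

Definition letter_of_code n c : option ('I_n * bool) :=
  omap (fun i => (i, odd c)) (insub c./2).

Definition parse n (w : seq nat) : word n := pmap (letter_of_code n) w.

Lemma odd_letter_code n (a : 'I_n * bool) : odd (letter_code a) = a.2.
Proof. by rewrite oddD odd_double addbF oddb. Qed.

Lemma half_letter_code n (a : 'I_n * bool) : (letter_code a)./2 = a.1.
Proof. exact: half_bit_double. Qed.

Lemma letter_codeK n : pcancel (@letter_code n) (letter_of_code n).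
Proof.
by move=> [i b]; rewrite /letter_of_code odd_letter_code half_letter_code /= valK.
Qed.

Lemma letter_code_inv n (a : 'I_n * bool) :
  letter_code (inv_letter a) = code_inv (letter_code a).
Proof. by rewrite /code_inv odd_letter_code; case: a => i []. Qed.

Lemma odd_code_inv c : odd (code_inv c) = ~~ odd c.
Proof. by rewrite /code_inv; case: c => [|c] //=; case oc: (odd c) => /=; rewrite ?oc. Qed.

Lemma half_code_inv c : (code_inv c)./2 = c./2.
Proof.
rewrite -{1}[c]odd_double_half /code_inv oddD odd_double addbF oddb.
by case: odd; rewrite /= ?add0n ?doubleK ?uphalf_double.
Qed.

Lemma letter_of_code_inv n c :
  letter_of_code n (code_inv c) = omap (@inv_letter n) (letter_of_code n c).
Proof.
by rewrite /letter_of_code half_code_inv odd_code_inv; case: insub.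
Qed.

Lemma rawK n : cancel (@raw n) (parse n).
Proof. by move=> w; rewrite /parse /raw (map_pK (@letter_codeK n)). Qed.

Lemma raw_cat n (u v : word n) : raw (u ++ v) = raw u ++ raw v.
Proof. exact: map_cat. Qed.

Lemma parse_cat n u v : parse n (u ++ v) = parse n u ++ parse n v.
Proof. exact: pmap_cat. Qed.

Lemma raw_inv n (w : word n) : raw (inv_word w) = codes_inv (raw w).
Proof.
rewrite /raw map_rev /codes_inv -!map_comp; congr rev.
by apply: eq_map => a; apply: letter_code_inv.
Qed.

Lemma parse_inv n w : parse n (codes_inv w) = inv_word (parse n w).
Proof.
elim: w => // c w IHw; rewrite /codes_inv /= rev_cons -cats1 parse_cat [parse n _]IHw.
rewrite {2 3}/parse /= letter_of_code_inv -/(parse n w).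
by case: letter_of_code => [a|] /=; rewrite ?cats0 // /inv_word /= rev_cons cats1.
Qed.

(** * Derivations in a finite presentation *)

(** The second disjunct recognises the words [c c^-1], with [c] read off [x]
    itself. *)
Definition insertable (R : seq (seq nat)) (x : seq nat) :=
  (x \in R) || (x == [:: head 0 x; code_inv (head 0 x)]).

(** A move [(a, x, b)] goes between [a b] and [a x b] in whichever direction applies
    and leaves every other word alone, so that a move undoes itself and derivability
    is symmetric. *)
Definition apply_move (R : seq (seq nat)) (w : seq nat) (m : seq nat * seq nat * seq nat) :=
  if insertable R m.1.2 then
    if w == m.1.1 ++ m.2 then m.1.1 ++ m.1.2 ++ m.2
    else if w == m.1.1 ++ m.1.2 ++ m.2 then m.1.1 ++ m.2 else w
  else w.

Definition derivable (R : seq (seq nat)) (u v : seq nat) : Prop :=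
  exists ms, foldl (apply_move R) u ms = v.

(** The two directions conflict only if [a b = a x b], and then the move is the
    identity. *)
Lemma apply_moveK R m : involutive (apply_move R ^~ m).
Proof.
case: m => [[a x] b] w; rewrite /apply_move /=; case: (insertable R x) => //.
case: (w =P a ++ b) => [->|neq1].
  by rewrite eqxx; case: eqP.
case: (w =P a ++ x ++ b) => [->|neq2]; first by rewrite eqxx.
by do 2!case: eqP => //.
Qed.

Lemma apply_move_cat R l r w a x b :
  apply_move R (l ++ w ++ r) (l ++ a, x, b ++ r) = l ++ apply_move R w (a, x, b) ++ r.
Proof.
have cat_eq (u v : seq nat) : (l ++ u ++ r == l ++ v ++ r) = (u == v).
  apply/eqP/eqP => [/(congr1 (drop (size l)))|-> //]; rewrite !drop_size_cat //.
  move=> e; have := congr1 rev e; rewrite !rev_cat => /(congr1 (drop (size (rev r)))).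
  by rewrite !drop_size_cat // => /(congr1 rev); rewrite !revK.
rewrite /apply_move /=; case: ifP => // _.
have -> : (l ++ a) ++ b ++ r = l ++ (a ++ b) ++ r by rewrite -!catA.
have -> : (l ++ a) ++ x ++ b ++ r = l ++ (a ++ x ++ b) ++ r by rewrite -!catA.
by rewrite !cat_eq; do 2!case: ifP => // _.
Qed.

Section Derivable.
Variable R : seq (seq nat).
Implicit Types u v w : seq nat.

Lemma derivable_refl w : derivable R w w.
Proof. by exists [::]. Qed.

Lemma derivable_trans u v w : derivable R u v -> derivable R v w -> derivable R u w.
Proof. by move=> [ms <-] [ns <-]; exists (ms ++ ns); rewrite foldl_cat. Qed.

Lemma derivable_sym u v : derivable R u v -> derivable R v u.
Proof.
move=> [ms <-]; exists (rev ms); elim: ms u => // m ms IHms u /=.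
by rewrite rev_cons -cats1 foldl_cat IHms /= apply_moveK.
Qed.

Lemma derivable_context l r u v : derivable R u v -> derivable R (l ++ u ++ r) (l ++ v ++ r).
Proof.
move=> [ms <-]; exists [seq (l ++ m.1.1, m.1.2, m.2 ++ r) | m <- ms].
by elim: ms u => // [[[a x] b]] ms IHms u /=; rewrite apply_move_cat IHms.
Qed.

Lemma derivable_cat u u' v v' :
  derivable R u u' -> derivable R v v' -> derivable R (u ++ v) (u' ++ v').
Proof.
move=> /(derivable_context [::] v) uu' /(derivable_context u' [::]).
by rewrite !cats0; apply: derivable_trans.
Qed.

Lemma derivable_insertable x : insertable R x -> derivable R x [::].
Proof.
move=> Rx; exists [:: ([::], x, [::])]; rewrite /= /apply_move /= Rx cats0 eqxx.
by case: eqP.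
Qed.

End Derivable.

(** Each move only inserts or deletes a word that is trivial after parsing. *)
Lemma derivable_weq (P : presentation) u v :
  derivable (map (@raw _) (relators P)) u v -> weq P (parse _ u) (parse _ v).
Proof.
set R := map _ _ => -[ms <-].
have mv w m : weq P (parse _ w) (parse _ (apply_move R w m)).
  rewrite /apply_move; case: ifP => [ins|_]; last exact: weq_refl.
  have x1 : weq P (parse _ m.1.2) [::].
    case/orP: ins => [/mapP[r Pr ->]|/eqP ->].
      by rewrite rawK; apply: weq_relator.
    rewrite /parse /= letter_of_code_inv.
    case: letter_of_code => [a|] /=; [exact: weq_cancel | exact: weq_refl].
  have x1E : weq P (parse _ (m.1.1 ++ m.1.2 ++ m.2)) (parse _ (m.1.1 ++ m.2)).
    rewrite !parse_cat; apply: weq_cat; first exact: weq_refl.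
    exact: (@weq_cat P _ [::]) x1 (weq_refl _).
  case: eqP => [->|_]; first exact: weq_sym.
  case: eqP => [->|_] //; exact: weq_refl.
elim: ms u => [|m ms IHms] w /=; first exact: weq_refl.
exact: weq_trans (mv w m) (IHms _).
Qed.

Lemma weq_derivable (P : presentation) u v :
  weq P u v -> derivable (map (@raw _) (relators P)) (raw u) (raw v).
Proof.
elim=> {u v} [w|u v _|u v w _ uv _ |u u' v v' _ uu' _ vv'|a|r Pr].
- exact: derivable_refl.
- exact: derivable_sym.
- exact: derivable_trans.
- by rewrite !raw_cat; apply: derivable_cat.
- by apply: derivable_insertable; rewrite /insertable /= letter_code_inv eqxx orbT.
- by apply: derivable_insertable; rewrite /insertable map_f.
Qed.

(** * Substitutions *)

Definition subst_word n m (f : 'I_n -> word m) (w : word n) : word m :=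
  flatten [seq if a.2 then inv_word (f a.1) else f a.1 | a <- w].

Definition subst_codes (F : seq (seq nat)) (w : seq nat) : seq nat :=
  flatten [seq if odd c then codes_inv (nth [::] F c./2) else nth [::] F c./2 | c <- w].

Definition raw_family n m (f : 'I_n -> word m) : seq (seq nat) :=
  [seq raw (f i) | i <- enum 'I_n].

Definition parse_family n m (F : seq (seq nat)) (i : 'I_n) : word m := parse m (nth [::] F i).

Lemma nth_raw_family n m (f : 'I_n -> word m) (i : 'I_n) :
  nth [::] (raw_family f) i = raw (f i).
Proof. by rewrite (nth_map i) ?size_enum_ord // nth_ord_enum. Qed.

Lemma size_raw_family n m (f : 'I_n -> word m) : size (raw_family f) = n.
Proof. by rewrite size_map size_enum_ord. Qed.

Lemma raw_familyK n m : cancel (@raw_family n m) (@parse_family n m).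
Proof. by move=> f; apply/funext => i; rewrite /parse_family nth_raw_family rawK. Qed.

(** The bound on [size F] ensures that the numbers skipped by [parse] are replaced by
    the empty word, the default value of [nth]. *)
Lemma parse_subst n m F w : size F <= n ->
  parse m (subst_codes F w) = subst_word (@parse_family n m F) (parse n w).
Proof.
move=> leFn; elim: w => //= c w IHw.
rewrite /subst_codes /= parse_cat [in LHS]IHw /letter_of_code.
case: insubP => [i _ ei|] /=; last first.
  rewrite -leqNgt => le_nc; rewrite nth_default ?(leq_trans leFn) //.
  by case: odd.
rewrite /subst_word /= -/(subst_word _ _); congr (_ ++ _).
by case: odd; rewrite ?parse_inv /parse_family ei.
Qed.

Lemma raw_subst n m (f : 'I_n -> word m) w :
  raw (subst_word f w) = subst_codes (raw_family f) (raw w).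
Proof.
elim: w => //= a w IHw; rewrite /subst_word /subst_codes /= raw_cat [X in _ ++ X]IHw.
rewrite odd_letter_code half_letter_code nth_raw_family; congr (_ ++ _).
by case: a.2; rewrite ?raw_inv.
Qed.

Lemma subst_word_cat n m (f : 'I_n -> word m) u v :
  subst_word f (u ++ v) = subst_word f u ++ subst_word f v.
Proof. by rewrite /subst_word map_cat flatten_cat. Qed.

Lemma inv_word_cat n (u v : word n) : inv_word (u ++ v) = inv_word v ++ inv_word u.
Proof. by rewrite /inv_word map_cat rev_cat. Qed.

Lemma subst_word_inv n m (f : 'I_n -> word m) w :
  subst_word f (inv_word w) = inv_word (subst_word f w).
Proof.
elim: w => // a w IHw; rewrite -cat1s inv_word_cat !subst_word_cat inv_word_cat IHw.
by congr (_ ++ _); rewrite /subst_word /= !cats0; case: a => i []; rewrite //= inv_wordK.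
Qed.

Lemma subst_word_gen n m (f : 'I_n -> word m) i : subst_word f [:: (i, false)] = f i.
Proof. by rewrite /subst_word /= cats0. Qed.

(** Words are generated by the generators under inversion and concatenation, so that
    identities between homomorphisms need only be checked on generators. *)
Lemma word_ind n (K : word n -> Prop) :
  K [::] -> (forall i, K [:: (i, false)]) ->
  (forall w, K w -> K (inv_word w)) -> (forall u v, K u -> K v -> K (u ++ v)) ->
  forall w, K w.
Proof.
move=> K0 K1 KV Kcat; elim=> // [[i b]] w Kw; rewrite -cat1s; apply: Kcat => //.
by case: b => //; apply: KV (K1 i).
Qed.

(** * Homomorphisms of presented groups *)

Definition respects (P Q : presentation) (f : 'I_(ngens P) -> word (ngens Q)) : Prop :=
  forall r, r \in relators P -> weq Q (subst_word f r) [::].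

(** Von Dyck: an assignment that kills the relators preserves all consequences of
    the relators. *)
Lemma weq_subst P Q (f : 'I_(ngens P) -> word (ngens Q)) u v :
  respects f -> weq P u v -> weq Q (subst_word f u) (subst_word f v).
Proof.
move=> fP; elim=> {u v} [w|u v _ /weq_sym //|u v w _ uv _ |u u' v v' _ uu' _ vv'|a|r /fP //].
- exact: weq_refl.
- exact: weq_trans.
- by rewrite !subst_word_cat; apply: weq_cat.
- rewrite -[[:: a; _]]/([:: a] ++ inv_word [:: a]) subst_word_cat subst_word_inv.
  exact: weq_mulV.
Qed.

Section Homomorphisms.
Local Open Scope group_scope.

Lemma multiplicative1 (G H : groupType) (phi : {multiplicative G -> H}) : phi 1 = 1.
Proof. by apply: (mulgI (phi 1)); rewrite -gmulfM !mulg1. Qed.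

Lemma multiplicativeV (G H : groupType) (phi : {multiplicative G -> H}) :
  {morph phi : x / x^-1}.
Proof.
by move=> x; apply: (mulgI (phi x)); rewrite -gmulfM !mulgV multiplicative1.
Qed.

Lemma multiplicative_of (G H : groupType) (f : G -> H) :
  {morph f : x y / x * y} -> exists phi : {multiplicative G -> H}, phi =1 f.
Proof.
move=> fM; pose m := isMultiplicative.Build G H f fM.
pose phi : {multiplicative G -> H} := HB.pack f m.
by exists phi.
Qed.

Lemma presents_isom (P Q : presentation) (G : groupType) :
  presents P G -> presents Q G <->
  exists phi : {multiplicative presented_group P -> presented_group Q}, bijective phi.
Proof.
move=> [f [f' fK f'K]]; split=> [[h [h' hK h'K]]|[phi [psi phiK psiK]]].
  have h'M := can2_gmulfM hK h'K.
  have [phi phiE] : exists phi : {multiplicative presented_group P -> presented_group Q},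
      phi =1 h' \o f.
    by apply: multiplicative_of => x y; rewrite /= gmulfM h'M.
  by exists phi; exists (f' \o h) => x; rewrite /= phiE /= ?h'K ?fK ?f'K ?hK.
have psiM := can2_gmulfM phiK psiK.
have [h hE] : exists h : {multiplicative presented_group Q -> G}, h =1 f \o psi.
  by apply: multiplicative_of => x y; rewrite /= psiM gmulfM.
by exists h; exists (phi \o f') => x; rewrite hE /= ?fK ?psiK ?phiK ?f'K.
Qed.

Variables P Q : presentation.
Implicit Types (f : 'I_(ngens P) -> word (ngens Q)).

Lemma hom_word f (phi : {multiplicative presented_group P -> presented_group Q}) :
  (forall i, phi (pg_gen i) = word_class (f i)) ->
  forall w, phi (word_class w) = word_class (subst_word f w).
Proof.
move=> phif; elim/word_ind => [|i|w IHw|u v IHu IHv].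
- exact: multiplicative1.
- by rewrite subst_word_gen -phif.
- by rewrite subst_word_inv !word_class_inv multiplicativeV IHw.
- by rewrite subst_word_cat !word_class_cat gmulfM IHu IHv.
Qed.

Definition extend f (x : presented_group P) : presented_group Q :=
  word_class (subst_word f (repr x)).

Lemma extend_word f w : respects f -> extend f (word_class w) = word_class (subst_word f w).
Proof. by move=> fP; apply/word_classP/weq_subst/weq_repr. Qed.

Lemma extendM f : respects f -> {morph extend f : x y / x * y}.
Proof.
move=> fP; elim/pg_ind=> u; elim/pg_ind=> v.
by rewrite -word_class_cat !extend_word // subst_word_cat word_class_cat.
Qed.

End Homomorphisms.

(** One half of the condition that [f] and [g] induce mutually inverse isomorphisms;
    the other half is the same condition with the roles of [f] and [g] exchanged. *)
Definition retraction (P Q : presentation) (f : 'I_(ngens P) -> word (ngens Q))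
    (g : 'I_(ngens Q) -> word (ngens P)) : Prop :=
  respects f /\ forall i, weq P (subst_word g (f i)) [:: (i, false)].

Lemma retraction_word P Q (f : 'I_(ngens P) -> word (ngens Q)) g w :
  retraction f g -> weq P (subst_word g (subst_word f w)) w.
Proof.
move=> [_ gf]; elim/word_ind: w => [|i|w IHw|u v IHu IHv].
- exact: weq_refl.
- by rewrite subst_word_gen.
- by rewrite !subst_word_inv; apply: weq_inv.
- by rewrite !subst_word_cat; apply: weq_cat.
Qed.

(** From an isomorphism, [g] is obtained by picking words that represent the images
    of the generators under its inverse. *)
Lemma retractionsP P Q (f : 'I_(ngens P) -> word (ngens Q)) :
  (exists phi : {multiplicative presented_group P -> presented_group Q},
     bijective phi /\ forall i, phi (pg_gen i) = word_class (f i)) <->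
  exists g, retraction f g /\ retraction g f.
Proof.
split=> [[phi [[psi phiK psiK] phif]]|[g [fg gf]]].
  have [psi' psi'E] := multiplicative_of (can2_gmulfM phiK psiK).
  have phiw := hom_word phif.
  pose g j := repr (psi (pg_gen j)).
  have psig j : psi' (pg_gen j) = word_class (g j).
    by rewrite psi'E /word_class reprK.
  have psiw := hom_word psig.
  exists g; split; split.
  - move=> r /weq_relator r1; apply/word_classP.
    by rewrite -phiw (word_classP r [::]).2 // multiplicative1.
  - by move=> i; apply/word_classP; rewrite -psiw -phif psi'E phiK.
  - move=> r /weq_relator r1; apply/word_classP.
    by rewrite -psiw (word_classP r [::]).2 // multiplicative1.
  - by move=> j; apply/word_classP; rewrite -phiw -psig psi'E psiK.
have [phi phiE] := multiplicative_of (extendM fg.1).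
have phiw w : phi (word_class w) = word_class (subst_word f w).
  by rewrite phiE (extend_word _ fg.1).
exists phi; split=> [|i]; last by rewrite phiw subst_word_gen.
exists (extend g); elim/pg_ind=> w.
  by rewrite phiw (extend_word _ gf.1); apply/word_classP/retraction_word.
by rewrite (extend_word _ gf.1) phiw; apply/word_classP/retraction_word.
Qed.

(** * Isomorphisms of encoded presentations *)

Definition raw_presentation (P : presentation) : nat * seq (seq nat) :=
  (ngens P, map (@raw _) (relators P)).

(** Counterpart of [retraction] on codes, with families of words given as lists;
    [i.*2] is the code of the [i]-th generator. *)
Definition raw_retraction (P Q : nat * seq (seq nat)) (F H : seq (seq nat)) : Prop :=
  (forall r, r \in P.2 -> derivable Q.2 (subst_codes F r) [::]) /\
  (forall i, i \in iota 0 P.1 -> derivable P.2 (subst_codes H (nth [::] F i)) [:: i.*2]).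

Definition raw_isomorphism (P Q : nat * seq (seq nat)) (F H : seq (seq nat)) : Prop :=
  [/\ size F = P.1, size H = Q.1, raw_retraction P Q F H & raw_retraction Q P H F].

Lemma raw_retraction_sound P Q F H :
  size F = ngens P -> size H = ngens Q ->
  raw_retraction (raw_presentation P) (raw_presentation Q) F H ->
  retraction (@parse_family (ngens P) (ngens Q) F) (@parse_family (ngens Q) (ngens P) H).
Proof.
move=> sF sH [/= fP hf]; split=> [r Pr|i].
  have := @derivable_weq Q _ _ (fP _ (map_f (@raw _) Pr)).
  by rewrite (@parse_subst (ngens P)) ?sF // rawK.
have /hf/(@derivable_weq P) : (i : nat) \in iota 0 (ngens P) by rewrite mem_iota /=.
rewrite (@parse_subst (ngens Q)) ?sH //.
by rewrite -[[:: i.*2]]/(raw [:: (i, false)]) rawK.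
Qed.

Lemma raw_retraction_complete P Q (f : 'I_(ngens P) -> word (ngens Q)) g :
  retraction f g ->
  raw_retraction (raw_presentation P) (raw_presentation Q) (raw_family f) (raw_family g).
Proof.
move=> [fP gf]; split=> /= [_ /mapP[r Pr ->]|i].
  by rewrite -raw_subst; apply: (weq_derivable (fP r Pr)).
rewrite mem_iota => /= lt_in; have := weq_derivable (gf (Ordinal lt_in)).
by rewrite raw_subst -(nth_raw_family f (Ordinal lt_in)).
Qed.

Lemma raw_isomorphism_sound P Q F H :
  raw_isomorphism (raw_presentation P) (raw_presentation Q) F H ->
  exists g, retraction (@parse_family (ngens P) (ngens Q) F) g /\
            retraction g (@parse_family (ngens P) (ngens Q) F).
Proof.
move=> [sF sH FH HF]; exists (@parse_family (ngens Q) (ngens P) H).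
by split; apply: raw_retraction_sound.
Qed.

Lemma raw_isomorphism_complete P Q (f : 'I_(ngens P) -> word (ngens Q)) g :
  retraction f g -> retraction g f ->
  raw_isomorphism (raw_presentation P) (raw_presentation Q) (raw_family f) (raw_family g).
Proof.
by move=> fg gf; split; rewrite ?size_raw_family //; apply: raw_retraction_complete.
Qed.

(** * Encoded standard presentations *)

(** Here [2n] and [2n + 1] are the codes of the stable letter and its inverse. As the
    stable letter comes last, lifting a word leaves its code unchanged. *)
Definition raw_standard_form (S : nat * seq (seq nat) * seq (seq nat)) :
    nat * seq (seq nat) :=
  let: n := S.1.1 in
  (n.+1, S.1.2 ++ [seq [:: n.*2; i.*2; n.*2.+1] ++ codes_inv (nth [::] S.2 i)
                  | i <- iota 0 n]).

Definition raw_standard_data (S : standard_data) :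
    nat * seq (seq nat) * seq (seq nat) :=
  (sX S, map (@raw _) (sR S), raw_family (salpha S)).

Lemma raw_lift n (w : word n) : raw (lift_word w) = raw w.
Proof.
rewrite /raw /lift_word -map_comp; apply: eq_map => -[i b].
by rewrite /letter_code /= /bump leqNgt ltn_ord.
Qed.

Lemma raw_standard_formE S :
  raw_presentation (standard_form S) = raw_standard_form (raw_standard_data S).
Proof.
congr (_, _); rewrite /= map_cat -map_comp; congr (_ ++ _).
  by apply: eq_map => r /=; rewrite raw_lift.
rewrite -[in RHS]val_enum_ord -!map_comp; apply: eq_map => i.
rewrite /= nth_raw_family -/(raw _) raw_inv raw_lift.
by rewrite /letter_code /= /bump leqNgt ltn_ord.
Qed.

(** The encoding of presentations coincides with the one that the canonical countable
    structure provides, for which computability is defined. *)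
Lemma words_codeE n (ws : seq (word n)) : words_code ws = pickle (map (@raw n) ws).
Proof.
rewrite [RHS]/(CodeSeq.code (map pickle (map (@raw n) ws))) -map_comp; congr CodeSeq.code.
by apply: eq_map => w; rewrite /= -[RHS]/(CodeSeq.code (map id _)) map_id.
Qed.

Lemma standard_codeE S :
  standard_code S = CodeSeq.code
    [:: sX S; pickle (map (@raw _) (sR S)); pickle (raw_family (salpha S))].
Proof.
by rewrite /standard_code !words_codeE /raw_family -(map_comp (@raw _) (salpha S)).
Qed.

(** A number that decodes to the right kind of list need not come from standard
    data: there must be one image word per generator, and only letters in range. *)
Definition raw_valid (S : nat * seq (seq nat) * seq (seq nat)) : bool :=
  (size S.2 == S.1.1) && all (all (fun c => c < S.1.1.*2)) (S.1.2 ++ S.2).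

Lemma parseK n w : all (fun c => c < n.*2) w -> raw (parse n w) = w.
Proof.
elim: w => //= c w IHw /andP[lt_c /IHw ew]; rewrite /parse /= /letter_of_code.
case: insubP => [i _ ei|]; last by rewrite ltn_half_double lt_c.
by rewrite /= [raw _]ew /letter_code /= ei odd_double_half.
Qed.

Lemma raw_validP S : raw_valid S -> exists T, raw_standard_data T = S.
Proof.
case: S => [[n R] A]; rewrite /raw_valid /= all_cat => /and3P[/eqP sA /allP okR /allP okA].
exists (@StandardData n (map (parse n) R) (@parse_family n n A)).
rewrite /raw_standard_data /=; congr (_, _, _).
  by rewrite -map_comp map_id_in // => r /okR; apply: parseK.
apply: (@eq_from_nth _ [::]) => [|i]; rewrite size_raw_family // => lt_in.
rewrite -[i]/(val (Ordinal lt_in)) nth_raw_family /parse_family parseK //.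
by apply: okA; rewrite mem_nth // sA.
Qed.

Lemma raw_letter_lt n (w : word n) : all (fun c => c < n.*2) (raw w).
Proof. by rewrite all_map; apply/allP => a _ /=; rewrite -ltn_half_double half_letter_code. Qed.

Lemma raw_valid_standard S : raw_valid (raw_standard_data S).
Proof.
rewrite /raw_valid size_raw_family eqxx all_cat /=; apply/andP.
by split; apply/allP => _ /mapP[w _ ->]; apply: raw_letter_lt.
Qed.

Definition standard_presentation_raw (e : nat * nat) (P : nat * seq (seq nat))
    (S : nat * seq (seq nat) * seq (seq nat)) : Prop :=
  [&& e.1 == pickle P,
      e.2 == CodeSeq.code [:: S.1.1; pickle S.1.2; pickle S.2] & raw_valid S] /\
  (exists B, raw_isomorphism S.1 S.1 S.2 B) /\
  (exists F H, raw_isomorphism P (raw_standard_form S) F H).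

(** * Semidecidability of being a standard presentation *)

Lemma computable_code_inv (E : countType) (c : E -> nat) :
  computable c -> computable (fun e => code_inv (c e)).
Proof. by move=> cc; rewrite /code_inv; compute_by. Qed.
#[local] Hint Resolve computable_code_inv : computable.

Lemma computable_codes_inv (E : countType) (w : E -> seq nat) :
  computable w -> computable (fun e => codes_inv (w e)).
Proof. by move=> cw; rewrite /codes_inv; compute_by. Qed.
#[local] Hint Resolve computable_codes_inv : computable.

Lemma computable_subst_codes (E : countType) (F : E -> seq (seq nat)) (w : E -> seq nat) :
  computable F -> computable w -> computable (fun e => subst_codes (F e) (w e)).
Proof. by move=> cF cw; rewrite /subst_codes; compute_by. Qed.
#[local] Hint Resolve computable_subst_codes : computable.

Lemma computable_apply_move (E : countType) (R : E -> seq (seq nat)) (w : E -> seq nat)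
    (m : E -> seq nat * seq nat * seq nat) :
  computable R -> computable w -> computable m ->
  computable (fun e => apply_move (R e) (w e) (m e)).
Proof. by move=> cR cw cm; rewrite /apply_move /insertable; compute_by. Qed.
#[local] Hint Resolve computable_apply_move : computable.

Lemma enumerable_word : enumerable (seq nat).
Proof. exact: enumerable_seq enumerable_nat. Qed.

Lemma enumerable_family : enumerable (seq (seq nat)).
Proof. exact: enumerable_seq enumerable_word. Qed.

Lemma semidecidable_derivable (E : countType) (R : E -> seq (seq nat)) (u v : E -> seq nat) :
  computable R -> computable u -> computable v ->
  semidecidable (fun e => derivable (R e) (u e) (v e)).
Proof.
move=> cR cu cv; have ew := enumerable_word.
apply: (@eq_semidecidable _ (fun e => exists ms, foldl (apply_move (R e)) (u e) ms == v e)).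
  by move=> e; split=> -[ms /eqP]; exists ms => //; apply/eqP.
apply: semidecidable_ex; first by apply: enumerable_seq; do !apply: enumerable_prod.
by apply: semidecidable_computable; compute_by.
Qed.

Lemma semidecidable_raw_retraction (E : countType) (P Q : E -> nat * seq (seq nat))
    (F H : E -> seq (seq nat)) :
  computable P -> computable Q -> computable F -> computable H ->
  semidecidable (fun e => raw_retraction (P e) (Q e) (F e) (H e)).
Proof.
move=> cP cQ cF cH; apply: semidecidable_and; apply: semidecidable_all; try compute_by;
  by apply: semidecidable_derivable; compute_by.
Qed.

Lemma semidecidable_raw_isomorphism (E : countType) (P Q : E -> nat * seq (seq nat))
    (F H : E -> seq (seq nat)) :
  computable P -> computable Q -> computable F -> computable H ->
  semidecidable (fun e => raw_isomorphism (P e) (Q e) (F e) (H e)).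
Proof.
move=> cP cQ cF cH.
apply: (@eq_semidecidable _ (fun e => ((size (F e) == (P e).1) && (size (H e) == (Q e).1)) /\
    (raw_retraction (P e) (Q e) (F e) (H e) /\ raw_retraction (Q e) (P e) (H e) (F e)))).
  by move=> e; split=> [[/andP[/eqP ? /eqP ?] []]|[-> -> ? ?]] //; rewrite !eqxx.
apply: semidecidable_and; first by apply: semidecidable_computable; compute_by.
by apply: semidecidable_and; apply: semidecidable_raw_retraction.
Qed.

Lemma semidecidable_standard_presentation :
  semidecidable (fun e => exists P S, standard_presentation_raw e P S).
Proof.
have eF := enumerable_family; have en := enumerable_nat.
do 2![apply: semidecidable_ex; first by do !apply: enumerable_prod].
apply: semidecidable_and.
  by apply: semidecidable_computable; rewrite /raw_valid; compute_by.
apply: semidecidable_and; apply: semidecidable_ex => //.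
  by apply: semidecidable_raw_isomorphism; compute_by.
apply: semidecidable_ex => //.
by apply: semidecidable_raw_isomorphism; rewrite /raw_standard_form; compute_by.
Qed.

Lemma presentation_codeE P : presentation_code P = pickle (raw_presentation P).
Proof. by rewrite /presentation_code words_codeE. Qed.

(** The assignment is prescribed here, so only its inverse is searched for. *)
Lemma defines_automorphismP S :
  defines_automorphism S <->
  exists B, raw_isomorphism (raw_presentation (base_presentation S))
              (raw_presentation (base_presentation S)) (raw_family (salpha S)) B.
Proof.
set X := base_presentation S.
split=> [/(@retractionsP X X)[g [fg gf]]|[B /(@raw_isomorphism_sound X X) iso]].
  by exists (raw_family g); apply: (@raw_isomorphism_complete X X).
by apply/(@retractionsP X X); rewrite raw_familyK in iso.
Qed.

Lemma isomorphicP (P Q : presentation) :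
  (exists phi : {multiplicative presented_group P -> presented_group Q}, bijective phi) <->
  exists F H, raw_isomorphism (raw_presentation P) (raw_presentation Q) F H.
Proof.
split=> [[phi bij_phi]|[F [H]]]; last first.
  by case/raw_isomorphism_sound/retractionsP=> phi []; exists phi.
pose f i := repr (phi (pg_gen i)).
have [|g [fg gf]] := (retractionsP f).1.
  by exists phi; split=> // i; rewrite /word_class reprK.
by exists (raw_family f), (raw_family g); apply: raw_isomorphism_complete.
Qed.

Theorem proposition7p1 :
  exists W : 2.-tuple nat -> Prop,
    recursively_enumerable W /\
    forall (G : groupType) (P : presentation),
      presents P G -> fp_by_Z G ->
      forall q : nat,
        W [tuple presentation_code P; q] <->
        exists S : standard_data,
          standard_presentation_for S G /\ q = standard_code S.
Proof.
exists (fun v => exists P S,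
  standard_presentation_raw (tnth v ord0, tnth v ord_max) P S).
split; first exact: semidecidable_re semidecidable_standard_presentation.
move=> G P PG _ q; rewrite !(tnth_nth 0) /=; split.
  case=> P' [S' [/and3P[/eqP eP /eqP eq /raw_validP[S def_S]]]]; subst S'.
  have -> : P' = raw_presentation P.
    by apply: (pcan_inj pickleK); rewrite -eP presentation_codeE.
  rewrite -raw_standard_formE => -[/defines_automorphismP autS /isomorphicP iso].
  exists S; split; last by rewrite standard_codeE.
  by split=> //; apply/(presents_isom _ PG).
case=> S [[autS SG] ->].
exists (raw_presentation P), (raw_standard_data S); split.
  by rewrite /= presentation_codeE standard_codeE !eqxx raw_valid_standard.
split; first exact/defines_automorphismP.
by rewrite -raw_standard_formE; apply/isomorphicP/(presents_isom _ PG).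
Qed.
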